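(* Let $\gamma>0$, let $s\ge1$ be a fixed real number and $k\ge2$ an integer. For real $\tau$ put $$a(\tau,s)=\Gamma(s+1)\sum_{j=1}^kj^{\tau-s},\qquad \sigma(\tau,s)=\left(\sum_{j=1}^kj^{2(\tau-s)}\right)^{1/2},$$ $$V(\tau,s)=\frac{a(\tau,s)}{\sigma(\tau,s)}\times\frac{s\,\gamma^{-1}}{\sqrt{\Gamma(2s+1)-\Gamma(s+1)^2}}.$$ Then, as a function of $\tau\in(s-1/2,+\infty)$, $V(\tau,s)$ has $\tau=s$ as its unique local maximum point, and its global maximum on $(s-1/2,+\infty)$ is reached at $\tau=s$. (Equivalently, $V(\tau,s)^{-2}$ is minimal at $\tau=s$.)
   Context: $\Gamma$ is Euler's Gamma function. Here $V(\tau,s)^{-2}$ plays the role of the asymptotic variance of an estimator of $\gamma$ indexed by $(\tau,s)$; the statement is purely about the explicit function $V$ above. *)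

(* Defs.v *)
From HB Require Import structures.
From mathcomp Require Import all_boot all_order all_algebra.
From mathcomp Require Import all_classical all_reals all_analysis.
Set Implicit Arguments.
Unset Strict Implicit.
Unset Printing Implicit Defensive.
Import Order.TTheory GRing.Theory Num.Theory.
Import numFieldNormedType.Exports.
Local Open Scope classical_set_scope.
Local Open Scope ring_scope.

(* Euler's integral of the second kind; it is Gamma(x) only for 0 < x. For
   x <= 0 the integral diverges and Rintegral returns the junk value 0. *)
Definition Gamma {R : realType} (x : R) : R :=
  \int[@lebesgue_measure R]_(t in `]0, +oo[) (t `^ (x - 1) * expR (- t)).

Definition acoef {R : realType} (k : nat) (tau s : R) : R :=
  Gamma (s + 1) * \sum_(1 <= j < k.+1) j%:R `^ (tau - s).

Definition sigma {R : realType} (k : nat) (tau s : R) : R :=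
  Num.sqrt (\sum_(1 <= j < k.+1) j%:R `^ (2 * (tau - s))).

Definition V {R : realType} (gamma : R) (k : nat) (tau s : R) : R :=
  acoef k tau s / sigma k tau s *
  (s * gamma^-1 / Num.sqrt (Gamma (2 * s + 1) - Gamma (s + 1) ^+ 2)).

(* Non-strict local maximum relative to D: only points of D near x compete. *)
Definition local_max_on {R : realType} (D : set R) (f : R -> R) (x : R) : Prop :=
  D x /\ \forall y \near within D (nbhs x), f y <= f x.

(* Main.v *)
Require Import Defs.
From HB Require Import structures.
From mathcomp Require Import all_boot all_order all_algebra.
From mathcomp Require Import all_classical all_reals all_analysis.
From mathcomp Require Import measurable_realfun ring lra.
Import Order.TTheory GRing.Theory Num.Theory.
Import numFieldNormedType.Exports.
Local Open Scope classical_set_scope.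
Local Open Scope ring_scope.

(* Up to a constant factor, V is f(u) = (sum_j j^u) / sqrt (sum_j j^(2u)) with
   u = tau - s. If v lies beyond u on the same side of 0 (or u = 0), then
   f(v) < f(u): put w = v - u; the sequences j^w and j^u are ordered the same
   way, so Chebyshev's sum inequality bounds the mean of j^w for the weights
   j^u by its mean for the weights j^(2u), and Cauchy-Schwarz for the latter is
   strict. Hence u = 0 is a global maximum, and any other point is beaten by
   points of the segment towards 0. The constant is positive because
   Gamma(2s+1) - Gamma(s+1)^2 is the variance of X^s for an exponential X. *)

(** * Chebyshev's sum inequality and the ratio of l1 to l2 norms *)

Lemma chebyshev_identity (R : comRingType) (I : finType) (w f g : I -> R) :
  \sum_i \sum_j w i * w j * ((f i - f j) * (g i - g j)) =
  2 * ((\sum_i w i * f i * g i) * (\sum_i w i) -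
       (\sum_i w i * f i) * (\sum_i w i * g i)).
Proof.
have sumM (F G : I -> R) :
    \sum_i \sum_j F i * G j = (\sum_i F i) * (\sum_i G i).
  by rewrite mulr_suml; apply: eq_bigr => i _; rewrite mulr_sumr.
transitivity (\sum_i \sum_j ((w i * f i * g i) * w j + w i * (w j * f j * g j)
    - (w i * f i) * (w j * g j) - (w i * g i) * (w j * f j))).
  by apply: eq_bigr => i _; apply: eq_bigr => j _; ring.
under eq_bigr do rewrite !sumrB big_split /=.
by rewrite !sumrB big_split /= !sumM; ring.
Qed.

(** Twice the gap between the sides is the double sum of [chebyshev_identity], whose terms are all
    nonnegative. *)
Lemma chebyshev_sum_le (R : realDomainType) (I : finType) (w f g : I -> R) :
  (forall i, 0 <= w i) -> (forall i j, 0 <= (f i - f j) * (g i - g j)) ->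
  (\sum_i w i * f i) * (\sum_i w i * g i) <=
  (\sum_i w i * f i * g i) * (\sum_i w i).
Proof.
move=> w0 fg; rewrite -subr_ge0 -(@pmulr_rge0 _ 2)// -chebyshev_identity.
by do 2 (apply: sumr_ge0 => ? _); rewrite mulr_ge0 ?fg// mulr_ge0.
Qed.

(** The term of the double sum at [(i, j)] is positive. With [f = g] this is the strict
    Cauchy-Schwarz inequality. *)
Lemma chebyshev_sum_lt (R : realDomainType) (I : finType) (w f g : I -> R)
    (i j : I) :
  (forall i, 0 < w i) -> (forall i j, 0 <= (f i - f j) * (g i - g j)) ->
  (f i - f j) * (g i - g j) != 0 ->
  (\sum_i w i * f i) * (\sum_i w i * g i) <
  (\sum_i w i * f i * g i) * (\sum_i w i).
Proof.
move=> w0 fg fgij.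
have term_ge0 a b : 0 <= w a * w b * ((f a - f b) * (g a - g b)).
  by rewrite mulr_ge0 ?fg// mulr_ge0// ltW.
rewrite -subr_gt0 -(@pmulr_rgt0 _ 2)// -chebyshev_identity.
rewrite lt_neqAle sumr_ge0 ?andbT => [|a _]; last by rewrite sumr_ge0.
rewrite eq_sym psumr_neq0 => [|a _]; last by rewrite sumr_ge0.
apply/hasP; exists i; rewrite ?mem_index_enum//=.
rewrite lt_neqAle sumr_ge0// andbT eq_sym psumr_neq0//.
apply/hasP; exists j; rewrite ?mem_index_enum//=.
by rewrite lt_neqAle term_ge0 andbT eq_sym mulf_neq0// mulf_neq0// gt_eqF.
Qed.

(** The index [i] witnesses that the sum is not empty. *)
Lemma sum_gt0 (R : numDomainType) (I : finType) (f : I -> R) (i : I) :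
  (forall i, 0 < f i) -> 0 < \sum_i f i.
Proof.
move=> f0; rewrite (bigD1 i)//= ltr_pwDl ?sumr_ge0// => j _; exact: ltW.
Qed.

(* With E the average for the weights b^2, Chebyshev gives
   (sum b x) / (sum b) <= E x and Cauchy-Schwarz gives (E x)^2 < E (x^2). *)
Lemma ratio_l1_l2_lt (R : rcfType) (I : finType) (b x : I -> R) (i j : I) :
  (forall i, 0 < b i) -> (forall i, 0 < x i) ->
  (forall i j, 0 <= (x i - x j) * (b i - b j)) -> x i != x j ->
  (\sum_i b i * x i) / Num.sqrt (\sum_i (b i * x i) ^+ 2) <
  (\sum_i b i) / Num.sqrt (\sum_i b i ^+ 2).
Proof.
move=> b0 x0 bx xij.
have bx0 k : 0 < b k * x k by rewrite mulr_gt0.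
have b20 k : 0 < b k ^+ 2 by rewrite exprn_gt0.
have bx20 k : 0 < (b k * x k) ^+ 2 by rewrite exprn_gt0.
have xx k l : 0 <= (x k - x l) * (x k - x l) by rewrite -expr2 sqr_ge0.
have xxij : (x i - x j) * (x i - x j) != 0 by rewrite mulf_neq0// subr_eq0.
have := @chebyshev_sum_le _ _ b x b (fun k => ltW (b0 k)) bx.
have := @chebyshev_sum_lt _ _ (fun k => b k ^+ 2) x x i j b20 xx xxij.
have -> : \sum_i b i ^+ 2 * x i * x i = \sum_i (b i * x i) ^+ 2.
  by apply: eq_bigr => k _; ring.
have -> : \sum_i b i * x i * b i = \sum_i b i ^+ 2 * x i.
  by apply: eq_bigr => k _; ring.
rewrite -[\sum_i b i * b i]/(\sum_i b i ^+ 2).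
have := sum_gt0 _ _ _ i b0; have := sum_gt0 _ _ _ i bx0.
have := sum_gt0 _ _ _ i b20; have := sum_gt0 _ _ _ i bx20.
have : 0 < \sum_i b i ^+ 2 * x i.
  by apply: (sum_gt0 _ _ _ i) => k; rewrite mulr_gt0.
move: (\sum_i b i ^+ 2 * x i) (\sum_i (b i * x i) ^+ 2) (\sum_i b i ^+ 2).
move: (\sum_i b i * x i) (\sum_i b i) => C A E F B E0 F0 B0 C0 A0 EFB CBEA.
rewrite -(@ltr_pXn2r _ 2)// ?nnegrE ?divr_ge0 ?sqrtr_ge0 ?ltW//.
rewrite !expr_div_n !sqr_sqrtr ?ltW// ltr_pdivrMr// mulrAC ltr_pdivlMr//.
(* The goal is now [C^2 * B < A^2 * F]. Multiplied by [B], it follows from [C * B <= E * A] squared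
   and [E * E < F * B]. *)
rewrite -(ltr_pM2r B0).
apply: (@le_lt_trans _ _ ((E * A) ^+ 2)).
  rewrite [leLHS](_ : _ = (C * B) ^+ 2); last by ring.
  by rewrite lerXn2r// nnegrE mulr_ge0// ltW.
rewrite [ltLHS](_ : _ = A ^+ 2 * (E * E)); last by ring.
by rewrite -[ltRHS]mulrA ltr_pM2l ?exprn_gt0.
Qed.

(** * Ratios of power sums *)

Section powers.
Variable R : realType.
Implicit Types u w : R.

Definition power_ratio (k : nat) u : R :=
  (\sum_(1 <= j < k.+1) j%:R `^ u) /
  Num.sqrt (\sum_(1 <= j < k.+1) j%:R `^ (2 * u)).

(** Exponents of the same sign make both powers increase or both decrease; for [u = 0] the second
    factor vanishes, whatever the sign of [w]. *)
Lemma powR_comonotone u w (x y : R) : 0 < x -> 0 < y -> 0 <= u * w ->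
  0 <= (x `^ w - y `^ w) * (x `^ u - y `^ u).
Proof.
wlog xy : x y / x <= y.
  move=> H x0 y0 uw; have [|/ltW] := leP x y; first by move/H; apply.
  by move=> /H/(_ y0 x0 uw); rewrite -mulrNN !opprB.
move=> x0 y0 uw.
have up (c : R) : 0 <= c -> x `^ c <= y `^ c.
  by move=> c0; rewrite ge0_ler_powR ?nnegrE// ltW.
have down (c : R) : c <= 0 -> y `^ c <= x `^ c.
  move=> c0; rewrite -(opprK c) !(powRN _ (- c)) lef_pV2 ?posrE ?powR_gt0//.
  by rewrite up// oppr_ge0.
have [u0|u0|u0] := ltgtP u 0.
- have w0 : w <= 0 by rewrite -(nmulr_rge0 _ u0).
  by rewrite mulr_ge0 ?subr_ge0 ?down// ltW.
- have w0 : 0 <= w by rewrite -(pmulr_rge0 _ u0).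
  by rewrite mulr_le0 ?subr_le0 ?up// ltW.
- by rewrite u0 !powRr0 subrr mulr0.
Qed.

Lemma power_ratio_lt (k : nat) u w : (2 <= k)%N -> w != 0 -> 0 <= u * w ->
  power_ratio k (u + w) < power_ratio k u.
Proof.
move=> k2 w0 uw; rewrite /power_ratio !big_add1 /= !big_mkord.
have pos (i : 'I_k) : 0 < i.+1%:R :> R by [].
have k1 : (1 < k)%N by [].
have k0 : (0 < k)%N by apply: leq_trans k1.
under [\sum_(i < k) _ `^ (u + w)]eq_bigr => i _
  do rewrite powRD ?pnatr_eq0 ?implybT//.
under [\sum_(i < k) _ `^ (2 * (u + w))]eq_bigr => i _
  do rewrite mulrC powRrM powR_mulrn ?powR_ge0// powRD ?pnatr_eq0 ?implybT//.
under [\sum_(i < k) _ `^ (2 * u)]eq_bigr => i _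
  do rewrite mulrC powRrM powR_mulrn ?powR_ge0//.
(* Here [b] is [j^u] and [x] is [j^w]. The ordinals 0 and 1 stand for the bases 1 and 2, and [2^w]
   differs from [1^w] because [w != 0]. *)
apply: (@ratio_l1_l2_lt _ _ _ _ (Ordinal k0) (Ordinal k1)).
- by move=> i; rewrite powR_gt0.
- by move=> i; rewrite powR_gt0.
- by move=> i j; apply: powR_comonotone.
- by rewrite /= powR1 eq_sym powR_eq1 !negb_or w0 pnatr_eq1 ltNge ler0n.
Qed.

Lemma power_ratio_gt0 (k : nat) u : (1 <= k)%N -> 0 < power_ratio k u.
Proof.
move=> k1; rewrite /power_ratio !big_add1 /= !big_mkord.
have sum0 (v : R) : 0 < \sum_(i < k) i.+1%:R `^ v.
  by apply: (sum_gt0 _ _ _ (Ordinal k1)) => i; rewrite powR_gt0.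
by rewrite divr_gt0 ?sqrtr_gt0.
Qed.

End powers.

(** * Integrability and positivity for the Gamma integral *)

Section Gamma.
Variable R : realType.
Notation mu := (@lebesgue_measure R).

Let mD : measurable (`]0, +oo[%classic : set (measurableTypeR R)).
Proof. exact: measurable_itv. Qed.

(** For [p > 0], raise [y <= 1 + y <= expR y] at [y = t / (2 * p)] to the power [p]. The rate 1/2
    leaves a factor [expR (- (t / 2))] to dominate the Gamma integrand. *)
Lemma powR_le_expR_half (p t : R) : 0 <= p -> 0 < t ->
  t `^ p <= (2 * p) `^ p * expR (t / 2).
Proof.
rewrite le0r => /orP[/eqP ->|p0] t0.
  by rewrite !powRr0 mul1r -expR0 ler_expR divr_ge0// ltW.
have q0 : 0 <= t / (2 * p) by rewrite divr_ge0 ?mulr_ge0 ?ltW.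
have -> : t `^ p = (2 * p) `^ p * (t / (2 * p)) `^ p.
  rewrite -powRM//; last by rewrite mulr_ge0// ltW.
  by congr (_ `^ p); field; rewrite gt_eqF.
rewrite ler_pM2l ?powR_gt0 ?mulr_gt0//.
rewrite (_ : t / 2 = t / (2 * p) * p); last by field; rewrite gt_eqF.
rewrite expRM ge0_ler_powR ?nnegrE ?expR_ge0 ?(ltW p0)//.
by rewrite (le_trans _ (expR_ge1Dx _))// lerDr.
Qed.

(** This is twice the exponential density of rate 1/2. *)
Lemma integrable_expR_half :
  mu.-integrable `]0, +oo[ (fun t => (expR (- (t / 2)))%:E).
Proof.
have h0 : 0 < 2^-1 :> R by rewrite invr_gt0.
have iexp : mu.-integrable `]0, +oo[ (EFin \o exponential_pdf 2^-1).
  by apply: integrableS (integrable_exponential_pdf h0).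
move: (integrableZl mD 2 iexp); apply: (eq_integrable mD).
move=> t; rewrite inE/= in_itv/= andbT => t0.
rewrite -EFinM exponential_pdfE ?ltW// mulrA divff// mul1r.
by congr (expR _)%:E; ring.
Qed.


Lemma measurable_gamma_integrand (D : set R) (p : R) :
  measurable_fun D (fun t : R => t `^ p * expR (- t)).
Proof.
apply: measurable_funTS; apply: measurable_funM => //.
by apply: measurableT_comp.
Qed.

Lemma integrable_gamma (p : R) : 0 <= p ->
  mu.-integrable `]0, +oo[ (EFin \o (fun t => t `^ p * expR (- t))).
Proof.
move=> p0.
have := integrable_expR_half.
move=> /(integrableZl mD ((2 * p) `^ p)).
apply: le_integrable => //.
  by apply/measurable_EFinP; exact: measurable_gamma_integrand.
move=> t /=; rewrite in_itv/= andbT => t0.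
rewrite lee_fin !ger0_norm ?mulr_ge0 ?powR_ge0 ?expR_ge0//.
rewrite (_ : expR (- (t / 2)) = expR (t / 2) * expR (- t)).
  by rewrite mulrA ler_pM2r ?expR_gt0// powR_le_expR_half.
by rewrite -expRD; congr expR; lra.
Qed.

(** On [[a, a + 1]] the integrand is at least [expR (- (a + 1))], and the interval has length 1, so
    this positive number bounds the integral from below. *)
Lemma Rintegral_expRN_gt0 (g : R -> R) (a : R) : 0 < a ->
  mu.-integrable `]0, +oo[ (EFin \o (fun t => g t * expR (- t))) ->
  (forall t : R, 0 < t -> 0 <= g t) -> (forall t, a <= t -> 1 <= g t) ->
  0 < \int[mu]_(t in `]0, +oo[) (g t * expR (- t)).
Proof.
move=> a0 ig g0 g1.
pose I : set R := `[a, a + 1]%classic.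
have mI : measurable (I : set (measurableTypeR R)) by exact: measurable_itv.
have sub : I `<=` (`]0, +oo[%classic : set R).
  by move=> t /=; rewrite !in_itv/= andbT => /andP[ta _]; rewrite (lt_le_trans a0).
apply: (@lt_le_trans _ _ (expR (- (a + 1)))); first exact: expR_gt0.
rewrite /Rintegral -lee_fin fineK; last exact: integrable_fin_num.
have mg := measurable_int _ ig.
apply: (@le_trans _ _ (\int[mu]_(t in I) (g t * expR (- t))%:E)%E);
  last first.
  apply: ge0_subset_integral => // t /=; rewrite in_itv/= andbT => t0.
  by rewrite lee_fin mulr_ge0 ?g0 ?expR_ge0.
apply: (@le_trans _ _ (\int[mu]_(t in I) (expR (- (a + 1)))%:E)%E).
  rewrite integral_cst//= lebesgue_measure_itv/= lte_fin ltrDl ltr01.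
  by rewrite -EFinB addrAC subrr add0r mule1.
apply: ge0_le_integral => //.
  exact: measurable_funS mg.
move=> t; rewrite /I/= in_itv/= => /andP[ta tb].
rewrite lee_fin -[leLHS]mul1r ler_pM ?expR_ge0 ?g1//.
by rewrite ler_expR lerN2.
Qed.

Lemma GammaD1E (p : R) :
  Gamma (p + 1) = \int[mu]_(t in `]0, +oo[) (t `^ p * expR (- t)).
Proof. by rewrite /Gamma addrK. Qed.

Lemma Gamma_gt0 (p : R) : 0 <= p -> 0 < Gamma (p + 1).
Proof.
move=> p0; rewrite GammaD1E; apply: (@Rintegral_expRN_gt0 _ 1) => //.
- exact: integrable_gamma.
- by move=> t _; rewrite powR_ge0.
- by move=> t t1; rewrite -(powRr0 t) ler_powR.
Qed.

Lemma Gamma1 : Gamma 1 = 1 :> R.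
Proof.
have := GammaD1E 0; rewrite add0r => ->.
(* Adding the endpoint 0 matches the support of the exponential density of rate 1, whose total mass
   is 1. *)
rewrite Rintegral_itv_obnd_cbnd; last exact: integrable_gamma.
rewrite /Rintegral -[RHS]/(fine 1%:E); congr fine.
rewrite -[RHS](@integral_exponential_pdf R 1 ltr01).
rewrite [LHS]integral_mkcond/=; apply: eq_integral => t _.
rewrite /exponential_pdf !patchE; case: ifPn => // _.
by rewrite powRr0 mulNr !mul1r.
Qed.

Lemma Gamma_sqr_lt (s : R) : 1 <= s -> Gamma (s + 1) ^+ 2 < Gamma (2 * s + 1).
Proof.
move=> s1; have s0 : 0 <= s by lra.
set c := Gamma (s + 1); have c0 : 0 < c by exact: Gamma_gt0.
have i0 := integrable_gamma _ (lexx 0).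
have i1 := integrable_gamma _ s0.
have i2 : mu.-integrable `]0, +oo[
    (EFin \o (fun t => t `^ (2 * s) * expR (- t))).
  by apply: integrable_gamma; lra.
have i1c : mu.-integrable `]0, +oo[
    (EFin \o (fun t => (- 2 * c) * (t `^ s * expR (- t)))).
  exact: (integrableZl mD (- 2 * c) i1).
have i0c : mu.-integrable `]0, +oo[
    (EFin \o (fun t => c ^+ 2 * (t `^ 0 * expR (- t)))).
  exact: (integrableZl mD (c ^+ 2) i0).
have i01 : mu.-integrable `]0, +oo[
    (EFin \o (fun t => (- 2 * c) * (t `^ s * expR (- t)) +
                       c ^+ 2 * (t `^ 0 * expR (- t)))).
  exact: (integrableD mD i1c i0c).
(* The constant term carries [t^0] so that it integrates to [c^2 * Gamma 1]; in all,
   [Gamma (2 * s + 1) - 2 * c * c + c^2]. *)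
have sqE t : (t `^ s - c) ^+ 2 * expR (- t) = t `^ (2 * s) * expR (- t) +
    ((- 2 * c) * (t `^ s * expR (- t)) + c ^+ 2 * (t `^ 0 * expR (- t))).
  by rewrite powRr0 mulrC [2 * s]mulrC powRrM powR_mulrn ?powR_ge0//; ring.
rewrite -subr_gt0.
rewrite (_ : _ - _ =
    \int[mu]_(t in `]0, +oo[) ((t `^ s - c) ^+ 2 * expR (- t))).
  (* For [t >= 1 + c], [s >= 1] gives [t^s >= t], hence [t^s - c >= 1]. *)
  apply: (@Rintegral_expRN_gt0 _ (1 + c)).
  - by rewrite addr_gt0.
  - rewrite (eq_fun sqE); exact: (integrableD mD i2 i01).
  - by move=> t _; rewrite sqr_ge0.
  move=> t ct; have t1 : 1 <= t by rewrite (le_trans _ ct)// lerDl ltW.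
  have ts : t <= t `^ s by rewrite le1r_powR.
  by rewrite exprn_ege1 //; lra.
rewrite (eq_fun sqE) !RintegralD// !RintegralZl//.
by rewrite -!GammaD1E add0r Gamma1 -/c; ring.
Qed.

End Gamma.

(** * Maxima of [V] *)

Lemma V_power_ratio (R : realType) (gamma s : R) (k : nat) :
  0 < gamma -> 1 <= s -> exists2 C, 0 < C &
  forall tau, V gamma k tau s = C * power_ratio _ k (tau - s).
Proof.
move=> g0 s1; have s0 : 0 < s by lra.
exists (Gamma (s + 1) *
  (s * gamma^-1 / Num.sqrt (Gamma (2 * s + 1) - Gamma (s + 1) ^+ 2))).
  rewrite mulr_gt0 ?Gamma_gt0 ?(ltW s0)//.
  rewrite divr_gt0 ?sqrtr_gt0 ?subr_gt0 ?Gamma_sqr_lt// divr_gt0//.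
by move=> tau; rewrite /V /acoef /sigma /power_ratio; ring.
Qed.

Theorem mainTheorem3 (R : realType) (gamma s : R) (k : nat)
    (hgamma : 0 < gamma) (hs : 1 <= s) (hk : (2 <= k)%N) :
  let D : set R := [set tau : R | s - 1 / 2 < tau] in
  (forall tau : R, local_max_on D (fun t : R => V gamma k t s) tau <-> tau = s) /\
  (forall tau : R, D tau -> V gamma k tau s <= V gamma k s s) /\
  (forall tau : R, D tau -> (V gamma k s s) ^- 2 <= (V gamma k tau s) ^- 2).
Proof.
move=> D; have [C C0 VE] := @V_power_ratio _ _ _ k hgamma hs.
have V0 tau : 0 < V gamma k tau s.
  by rewrite VE mulr_gt0// power_ratio_gt0// ltnW.
(* The sign condition says that [tau'] lies on the segment from [s] to [tau]. *)
have Vlt tau tau' : tau != tau' -> 0 <= (tau' - s) * (tau - tau') ->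
    V gamma k tau s < V gamma k tau' s.
  move=> tt ut; rewrite !VE ltr_pM2l//.
  rewrite [tau - s](_ : _ = tau' - s + (tau - tau')); last by ring.
  by rewrite power_ratio_lt// subr_eq0.
have Vmax tau : V gamma k tau s <= V gamma k s s.
  have [->//|ts] := eqVneq tau s.
  by rewrite ltW// Vlt// subrr mul0r.
split; last split => [|tau _]; [move=> tau; split|by []|].
- move=> [Dtau /nbhs_ballP[e /= e0 He]]; apply/eqP; apply: contrapT => /negP ts.
  set d := `|s - tau|.
  have d0 : 0 < d by rewrite normr_gt0 subr_eq0 eq_sym.
  have ed0 : 0 < e + d by rewrite addr_gt0.
  (* This choice gives [0 < t < 1] and [t * d < e]: moving from [tau] towards [s] by the fraction
     [t] stays inside the ball of radius [e]. *)
  pose t := e / (e + d).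
  have t0 : 0 < t by rewrite divr_gt0.
  have t1 : t < 1 by rewrite ltr_pdivrMr// mul1r ltrDl.
  pose y := tau + t * (s - tau).
  have ball_y : ball tau e y.
    rewrite /ball/= /y opprD addNKr normrN normrM (gtr0_norm t0) -/d.
    by rewrite mulrAC ltr_pdivrMr// ltr_pM2l// ltrDr.
  (* The point [y] is a convex combination of [tau] and [s], both in the half-line [D]. *)
  have Dy : D y by move: Dtau; rewrite /D/= /y; nra.
  have := He _ ball_y Dy; apply/negP; rewrite -ltNge Vlt//.
    by rewrite /y -subr_eq0 opprD addNKr oppr_eq0 mulf_neq0 ?(gt_eqF t0) ?subr_eq0  1?[s == _]eq_sym//.
  have -> : (y - s) * (tau - y) = (1 - t) * t * (s - tau) ^+ 2.
    by rewrite /y; ring.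
  by rewrite mulr_ge0 ?sqr_ge0// mulr_ge0 ?subr_ge0 ?ltW.
- move=> ->; split; first by rewrite /D/=; lra.
  by near=> y.
(* Since [V] is positive, squaring keeps the order of [Vmax] and inversion reverses it. *)
- by rewrite lef_pV2 ?posrE ?exprn_gt0// lerXn2r// nnegrE ltW.
Unshelve. all: by end_near. Qed.
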